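(* Let $(\Omega,S,V,\pi)$ be a monotone system with $|V|=n$ sites, $|S|\ge2$ and $\Omega=S^V$. Consider the Glauber dynamics on $\Omega$, with separation distance $s(t)$ and total variation distance $d(t)$ at time $t$. Let $c>0$. (1) If $t=n\log n-cn\ge 0$, then $s(t)\ge 1-e^{-e^c}$. (2) If $t=\frac12 n\log n-cn\ge0$, then $d(t)\ge\frac14-\frac14e^{-e^c}$.
   Context: A system $(\Omega,S,V,\pi)$ consists of a finite set $S$ of spins, a finite set $V$ of sites, the set of configurations $\Omega=S^V$, and a probability distribution $\pi$ on $\Omega$ with $\pi(\sigma)>0$ for all $\sigma\in\Omega$. $S$ is totally ordered and $\Omega$ carries the coordinate-wise partial order. For $\sigma\in\Omega$, $u\in V$, $s\in S$, let $\sigma_u^s$ be the configuration obtained from $\sigma$ by changing its value at $u$ to $s$, and $\sigma_u^\bullet=\{\sigma_u^s:s\in S\}$. The system is monotone if for all $\sigma\le\tau$ in $\Omega$ and $u\in V$, the probability distribution $\{\pi(\tau_u^s)/\pi(\tau_u^\bullet)\}_{s\in S}$ on $S$ stochastically dominates $\{\pi(\sigma_u^s)/\pi(\sigma_u^\bullet)\}_{s\in S}$. Glauber dynamics: the Markov chain on $\Omega$ which from $\sigma$ picks a site $u\in V$ uniformly at random and moves to $\sigma_u^s$ with probability $\pi(\sigma_u^s)/\pi(\sigma_u^\bullet)$, $s\in S$. It has stationary distribution $\pi$. Let $P^t$ denote its $t$-step transition probabilities. $s(t)=\max_{x\in\Omega}\left(1-\min_{y\in\Omega}\frac{P^t(x,y)}{\pi(y)}\right)$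 and $d(t)=\max_{x\in\Omega}\|P^t(x,\cdot)-\pi\|_{TV}$ for integers $t\ge0$ (with $\|\mu-\nu\|_{TV}=\frac12\sum_y|\mu(y)-\nu(y)|$); for real $t\ge0$ these are evaluated at $\lfloor t\rfloor$. *)

(* Defs.v *)
From HB Require Import structures.
From mathcomp Require Import all_boot all_order all_algebra.
From mathcomp Require Import all_classical all_reals all_analysis.

Set Implicit Arguments.
Unset Strict Implicit.
Unset Printing Implicit Defensive.

Import Order.TTheory GRing.Theory Num.Theory.
Local Open Scope ring_scope.

Section SpinSystem.
Context {R : realType} {d : Order.disp_t} {S : finOrderType d} {V : finType}.

Definition config := {ffun V -> S}.

Implicit Types (sigma tau x y : config) (u : V) (s : S) (pi : config -> R).

Definition config_le sigma tau : Prop := forall v, (sigma v <= tau v)%O.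

Definition upd sigma u s : config :=
  [ffun v => if v == u then s else sigma v].

Definition upd_set sigma u : {set config} := [set upd sigma u s | s : S].

Definition positive_distribution pi : Prop :=
  (forall sigma, 0 < pi sigma) /\ \sum_sigma pi sigma = 1.

Definition measure_of pi (A : {set config}) : R := \sum_(x in A) pi x.

Definition cond_spin pi sigma u s : R :=
  pi (upd sigma u s) / measure_of pi (upd_set sigma u).

Definition stoch_dominates (nu mu : S -> R) : Prop :=
  forall s, \sum_(r | (s <= r)%O) mu r <= \sum_(r | (s <= r)%O) nu r.

Definition monotone_system pi : Prop :=
  forall sigma tau, config_le sigma tau ->
  forall u, stoch_dominates (cond_spin pi tau u) (cond_spin pi sigma u).

Definition glauber pi x y : R :=
  \sum_(u : V) #|V|%:R^-1 *
    \sum_(s : S | upd x u s == y) cond_spin pi x u s.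

Fixpoint glauber_iter pi (t : nat) x y : R :=
  if t is t'.+1 then \sum_z glauber pi x z * glauber_iter pi t' z y
  else (x == y)%:R.

(* [sup] and [inf] below are taken over the range of a function on the finite
   type [config], hence are a maximum and a minimum when [S] is inhabited. *)
Definition sep_dist pi (t : nat) : R :=
  sup (range (fun x => 1 - inf (range (fun y => glauber_iter pi t x y / pi y)))).

Definition tv_norm (mu nu : config -> R) : R :=
  2^-1 * \sum_y `|mu y - nu y|.

Definition tv_dist pi (t : nat) : R :=
  sup (range (fun x => tv_norm (glauber_iter pi t x) pi)).

(* [Num.truncn t] is the integer part of [t] when [0 <= t]. *)
Definition sep_dist_at pi (t : R) : R := sep_dist pi (Num.truncn t).
Definition tv_dist_at pi (t : R) : R := tv_dist pi (Num.truncn t).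

End SpinSystem.

Arguments config {d} S V.

(* Main.v *)
Require Import Defs.
From HB Require Import structures.
From Stdlib Require Import NArith.
From mathcomp Require Import all_boot all_order all_algebra.
From mathcomp Require Import all_classical all_reals all_analysis.
From mathcomp Require Import complex ring lra.
Set Implicit Arguments.
Unset Strict Implicit.
Unset Printing Implicit Defensive.
Import Order.TTheory GRing.Theory Num.Theory.
Import numFieldNormedType.Exports.
Local Open Scope ring_scope.

(* Let [bot] and [top] be the constant configurations with minimal and maximal
   spin. The function [x |-> P^t(x, bot) / pi(bot)] is an average, over the
   sequences of [t] updated sites, of functions of [pi]-mean 1 which are
   decreasing because the system is monotone; such a function is at most 1 at
   [top], and it vanishes at [top] if some site is not updated. So
   [P^t(top, bot) / pi(bot)] is at most the probability that a coupon collector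
   is done at time [t].

   The generating polynomial of the number of missing coupons is, up to
   reversal, obtained from [(X - 1)^n] by iterating [p |-> X p' / n], hence
   equals [\prod_i (X - p_i)] with [p_i] in [[0, 1]] (Gauss-Lucas). So the
   probability of no missing coupon is [\prod_i (1 - p_i) <=
   exp (- \sum_i p_i - \sum_i p_i^2 / 2)], and both sums are explicit. Using the
   second-order term, this is at most [exp (- n exp (- t / n))] as soon as
   [n exp (- t / n) >= 1], which the first-order term alone does not give.

   The bound on total variation follows from the one on separation at time
   [2 t], since for a reversible chain [s(2 t) <= 4 d(t)]. *)

(** * Polynomials with real roots and coupon collecting *)

Lemma sumr_seq_gt0 (R : numDomainType) (I : eqType) (r : seq I) (F : I -> R) :
  r != [::] -> {in r, forall i, 0 < F i} -> 0 < \sum_(i <- r) F i.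
Proof.
case: r => [//|a r] _ F_gt0; rewrite big_cons ltr_pwDl ?F_gt0 ?mem_head //.
rewrite big_seq; apply: sumr_ge0 => i ir; apply/ltW/F_gt0.
by rewrite in_cons ir orbT.
Qed.

(** Logarithmic derivative of a split polynomial. *)
Lemma deriv_prod_XsubC_horner (F : fieldType) (rs : seq F) (w : F) :
  w \notin rs ->
  (\prod_(z <- rs) ('X - z%:P))^`().[w] =
  (\prod_(z <- rs) ('X - z%:P)).[w] * \sum_(z <- rs) (w - z)^-1.
Proof.
elim: rs => [|z rs IHrs]; first by rewrite !big_nil derivC !hornerE.
rewrite in_cons negb_or => /andP[wz /IHrs IH].
rewrite !big_cons derivM derivXsubC !hornerE IH.
by field; rewrite subr_eq0.
Qed.

(* Gauss-Lucas on a real interval: a root [w] of the derivative which is not a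
   root of the polynomial satisfies [\sum_z (w - z)^-1 = 0], impossible if [w]
   is not real (imaginary parts) or lies outside [[a, b]] (signs). *)
Lemma deriv_prod_XsubC_itv (R : rcfType) (a b : R) (rs : seq R) :
  rs != [::] -> {in rs, forall z, a <= z <= b} ->
  exists rs', [/\ size rs = (size rs').+1, {in rs', forall z, a <= z <= b} &
   (\prod_(z <- rs) ('X - z%:P))^`() =
   (size rs)%:R *: \prod_(z <- rs') ('X - z%:P)].
Proof.
move=> rs0 rs_itv; pose toC : {rmorphism R -> R[i]} := real_complex R.
pose p := \prod_(z <- rs) ('X - z%:P) : {poly R}.
have szr : size rs = (size rs).-1.+1 by case: (rs) rs0.
have szp : size p = (size rs).+1 by rewrite size_prod_XsubC.
have mp : p \is monic by apply: monic_prod_XsubC.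
have lead_dp : p^`()`_(size rs).-1 = (size rs)%:R.
  have := mp; rewrite monicE lead_coefE szp /= => /eqP.
  by rewrite coef_deriv -szr => ->.
have sz_dp : size p^`() = size rs.
  apply/eqP; rewrite eqn_leq; apply/andP; split.
    by rewrite -ltnS -szp lt_size_deriv // monic_neq0.
  rewrite szr; apply: contraTT isT; rewrite -leqNgt => /leq_sizeP/(_ _ (leqnn _)).
  by move/eqP; rewrite lead_dp pnatr_eq0 szr.
have lc_dp : lead_coef p^`() = (size rs)%:R by rewrite lead_coefE sz_dp.
have [ws dp_eq] := closed_field_poly_normal (map_poly toC p^`()).
have ws_real : {in ws, forall w, exists2 x : R, a <= x <= b & w = toC x}.
  move=> w w_ws.
  have dpw : (map_poly toC p)^`().[w] = 0.
    rewrite deriv_map dp_eq hornerZ; apply/eqP; rewrite mulf_eq0; apply/orP.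
    by right; rewrite -[_ == 0]/(root _ _) root_prod_XsubC.
  have pE : map_poly toC p = \prod_(z <- map toC rs) ('X - z%:P).
    by rewrite map_prod_XsubC big_map.
  have [w_rs|w_rs] := boolP (w \in map toC rs).
    by case/mapP: w_rs => x xrs ->; exists x => //; apply: rs_itv.
  move: dpw; rewrite pE (deriv_prod_XsubC_horner w_rs) => /eqP.
  rewrite mulf_eq0 -[_ == 0]/(root _ _) root_prod_XsubC (negPf w_rs) /=.
  rewrite big_map.
  case: w w_rs {w_ws pE} => x y w_rs /eqP sum0.
  (* [D z] is the squared modulus of [w - z], the denominator of both the real and the imaginary
     part of its inverse. *)
  pose D z := (x - z) ^+ 2 + y ^+ 2.
  have invE z : ((x +i* y)%C - toC z)^-1 = ((x - z) / D z -i* (y / D z))%C.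
    by rewrite /D -[in RHS](subr0 y).
  have Im_sum : \sum_(z <- rs) y / D z = 0.
    apply/eqP; rewrite -oppr_eq0 -sumrN; apply/eqP.
    rewrite -[RHS](congr1 (@complex.Im R) sum0).
    rewrite (big_morph (@complex.Im R) (id1 := 0) (op1 := +%R)) //; last first.
      by case=> ? ? [].
    by apply: eq_bigr => z _; rewrite invE.
  have Re_sum : \sum_(z <- rs) (x - z) / D z = 0.
    rewrite -[RHS](congr1 (@complex.Re R) sum0).
    rewrite (big_morph (@complex.Re R) (id1 := 0) (op1 := +%R)) //; last first.
      by case=> ? ? [].
    by apply: eq_bigr => z _; rewrite invE.
  have y0 : y = 0.
    apply/eqP/negP => /negP y_neq0; suff: 0 < \sum_(z <- rs) (D z)^-1.
      move: Im_sum; rewrite -mulr_sumr => /eqP; rewrite mulf_eq0 (negPf y_neq0).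
      by move=> /eqP ->; rewrite ltxx.
    apply: sumr_seq_gt0 => // z _.
    by rewrite invr_gt0 ltr_wpDl ?sqr_ge0 // exprn_even_gt0.
  (* At [x = z] both sides are 0, since the inverse of 0 is 0. *)
  have xzE z : (x - z) / D z = (x - z)^-1.
    rewrite /D y0 expr0n addr0 expr2.
    by have [->|xz0] := eqVneq (x - z) 0; [rewrite mul0r invr0|field].
  rewrite y0 in w_rs *; exists x => //.
  rewrite !leNgt -negb_or; apply/negP => /orP[xa|bx].
    have: 0 < \sum_(z <- rs) - ((x - z) / D z).
      apply: sumr_seq_gt0 => // z /rs_itv /andP[az _].
      by rewrite xzE -invrN invr_gt0; lra.
    by rewrite sumrN Re_sum oppr0 ltxx.
  have: 0 < \sum_(z <- rs) ((x - z) / D z).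
    apply: sumr_seq_gt0 => // z /rs_itv /andP[_ zb].
    by rewrite xzE invr_gt0; lra.
  by rewrite Re_sum ltxx.
exists (map (@complex.Re R) ws).
have wsE : ws = map toC (map (@complex.Re R) ws).
  rewrite -map_comp -[LHS]map_id; apply/eq_in_map => w /ws_real[x _ ->] //.
split.
- rewrite size_map; have := congr1 (fun q : {poly R[i]} => size q) dp_eq.
  rewrite size_map_poly sz_dp size_scale ?size_prod_XsubC //.
  by rewrite lead_coef_map lc_dp fmorph_eq0 pnatr_eq0 szr.
- by move=> _ /mapP[w /ws_real[x xab ->] ->].
- apply: (map_poly_inj toC); rewrite dp_eq lead_coef_map lc_dp.
  by rewrite map_polyZ map_prod_XsubC [in LHS]wsE big_map.
Qed.

Lemma coef_prod_XsubC_subleading (R : comNzRingType) (rs : seq R) (m : nat) :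
  size rs = m.+1 -> (\prod_(z <- rs) ('X - z%:P))`_m = - \sum_(z <- rs) z.
Proof.
elim: rs m => [//|z rs IHrs] m [szr]; rewrite !big_cons mulrBl coefB mulrC.
have lc : (\prod_(z <- rs) ('X - z%:P))`_m = 1.
  have /eqP := monic_prod_XsubC rs predT id.
  by rewrite lead_coefE size_prod_XsubC szr.
rewrite coefMX coefCM lc mulr1; case: m szr {lc} => [|m] szr /=.
  by rewrite (size0nil szr) !big_nil addr0 sub0r.
by rewrite IHrs // opprD addrC.
Qed.

(** Newton's identity: both sides are twice the second elementary symmetric function of the roots.
    The doubling avoids a division. *)
Lemma coef_prod_XsubC_subsubleading (R : comNzRingType) (rs : seq R) (m : nat) :
  size rs = m.+2 ->
  (\prod_(z <- rs) ('X - z%:P))`_m *+ 2 =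
  (\sum_(z <- rs) z) ^+ 2 - \sum_(z <- rs) z ^+ 2.
Proof.
elim: rs m => [//|z rs IHrs] m [szr]; rewrite !big_cons mulrBl coefB mulrC.
rewrite coefMX coefCM (coef_prod_XsubC_subleading szr).
case: m szr => [|m] szr /=.
  by case: rs szr {IHrs} => [//|y []//] _; rewrite !big_seq1; ring.
by rewrite mulrnBl IHrs //; ring.
Qed.

(** * The coupon collector polynomial and its roots *)

Section CouponPolynomial.
Variables (R : rcfType) (n : nat).
Hypothesis n_gt0 : (0 < n)%N.

Let n_neq0 : n%:R != 0 :> R. Proof. by rewrite pnatr_eq0 -lt0n. Qed.

(* If [p = \sum_i c_i X^(n-i)(X-1)^i] and [c_i] is the probability that [i]
   coupons are missing, then [coupon_op p] describes the situation after one
   more draw. *)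
Definition coupon_op (p : {poly R}) : {poly R} := n%:R^-1 *: ('X * p^`()).

(** The state with exactly [k] coupons missing, in the encoding used for [coupon_op]. *)
Definition coupon_basis (k : nat) : {poly R} := ('X - 1) ^+ k * 'X^(n - k).

(** Evaluation at 1 kills every term with a missing coupon. What remains is the probability that [t]
    draws find all of [k] missing coupons. *)
Definition coupon_prob (t k : nat) : R := (iter t coupon_op (coupon_basis k)).[1].

Lemma coupon_opD p q : coupon_op (p + q) = coupon_op p + coupon_op q.
Proof. by rewrite /coupon_op derivD mulrDr scalerDr. Qed.

Lemma coupon_opZ a p : coupon_op (a *: p) = a *: coupon_op p.
Proof. by rewrite /coupon_op derivZ -scalerAr !scalerA mulrC. Qed.

Lemma iter_coupon_opD t p q :
  iter t coupon_op (p + q) = iter t coupon_op p + iter t coupon_op q.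
Proof. by elim: t => //= t ->; rewrite coupon_opD. Qed.

Lemma iter_coupon_opZ t a p : iter t coupon_op (a *: p) = a *: iter t coupon_op p.
Proof. by elim: t => //= t ->; rewrite coupon_opZ. Qed.

(** A draw hits one of the [k] missing coupons with probability [k / n]. For [k = 0] the term with
    [k.-1] has coefficient 0. *)
Lemma coupon_op_basis k : (k <= n)%N ->
  coupon_op (coupon_basis k) =
  (k%:R / n%:R) *: coupon_basis k.-1 + (1 - k%:R / n%:R) *: coupon_basis k.
Proof.
move=> kn; rewrite /coupon_op /coupon_basis.
have -> : 1 - k%:R / n%:R = (n - k)%:R / n%:R :> R by rewrite natrB //; field.
rewrite derivM !deriv_exp derivB derivX derivC subr0 !mul1r.
rewrite ![_ / n%:R]mulrC -!scalerA -scalerDr; congr (_ *: _).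
rewrite !scaler_nat mulrDr; congr (_ + _).
  case: k kn => [|k] kn; first by rewrite !mulr0n mul0r mulr0.
  by rewrite mulrnAl mulrnAr /= -(subnSK kn) [in RHS]exprS; congr (_ *+ _); ring.
case: (n - k)%N => [|j]; rewrite ?mulr0n ?mulr0 //= mulrnAr mulrnAr exprS.
by congr (_ *+ _); ring.
Qed.

Lemma coupon_prob0 k : (k <= n)%N -> coupon_prob 0 k = (k == 0%N)%:R.
Proof.
move=> kn; rewrite /coupon_prob /= /coupon_basis !hornerE.
by rewrite subrr expr0n expr1n mulr1.
Qed.

Lemma coupon_probS t k : (k <= n)%N ->
  coupon_prob t.+1 k =
  k%:R / n%:R * coupon_prob t k.-1 + (1 - k%:R / n%:R) * coupon_prob t k.
Proof.
move=> kn; rewrite /coupon_prob iterSr coupon_op_basis //.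
by rewrite iter_coupon_opD !iter_coupon_opZ !hornerE.
Qed.

(** Monomials are eigenvectors of [coupon_op]. This makes the top coefficients explicit, hence the
    first two power sums of the roots. *)
Lemma coef_iter_coupon_op t p i :
  (iter t coupon_op p)`_i = (i%:R / n%:R) ^+ t * p`_i.
Proof.
elim: t => [|t IHt] /=; first by rewrite mul1r.
rewrite /coupon_op coefZ mulrC -commr_polyX coefMX; case: i IHt => [|i] IHt /=.
  by rewrite !mul0r expr0n mul0r.
by rewrite coef_deriv IHt -mulr_natl exprS; ring.
Qed.

Lemma coupon_basisE : coupon_basis n = \prod_(z <- nseq n 1) ('X - z%:P).
Proof. by rewrite big_nseq iter_mulr_1 /coupon_basis subnn mulr1. Qed.

(** Differentiation keeps the roots in [0, 1] and loses one, which the factor ['X] gives back as the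
    root 0; division by [n] keeps the polynomial monic. *)
Lemma iter_coupon_op_roots t :
  exists rs : seq R, [/\ size rs = n, {in rs, forall z, 0 <= z <= 1} &
    iter t coupon_op (coupon_basis n) = \prod_(z <- rs) ('X - z%:P)].
Proof.
elim: t => [|t [rs [szr rs01 IHt]]].
  exists (nseq n 1); split; first by rewrite size_nseq.
    by move=> z /nseqP[-> _]; rewrite ler01 lexx.
  exact: coupon_basisE.
have rs0 : rs != [::] by rewrite -size_eq0 szr -lt0n.
have [rs' [szr' rs'01 dE]] := deriv_prod_XsubC_itv rs0 rs01.
exists (0 :: rs'); split; first by rewrite /= -szr'.
  by move=> z; rewrite in_cons => /predU1P[->|/rs'01 //]; rewrite ler01 lexx.
rewrite /= IHt /coupon_op dE szr -scalerAr scalerA mulVf // scale1r.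
by rewrite big_cons subr0.
Qed.

Lemma iter_coupon_op_sum_roots t (rs : seq R) : size rs = n ->
  iter t coupon_op (coupon_basis n) = \prod_(z <- rs) ('X - z%:P) ->
  \sum_(z <- rs) z = n%:R * (1 - n%:R^-1) ^+ t.
Proof.
move=> szr rsE; apply: oppr_inj.
rewrite -(@coef_prod_XsubC_subleading _ _ n.-1) ?prednK // -rsE.
rewrite coef_iter_coupon_op coupon_basisE coef_prod_XsubC_subleading; last first.
  by rewrite size_nseq prednK.
rewrite big_nseq iter_addr_0 -subn1 natrB // mulrBl divff // mul1r.
by rewrite mulrN mulrC.
Qed.

Lemma iter_coupon_op_sum_sqr_roots t (rs : seq R) : size rs = n -> (1 < n)%N ->
  iter t coupon_op (coupon_basis n) = \prod_(z <- rs) ('X - z%:P) ->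
  \sum_(z <- rs) z ^+ 2 =
  (n%:R * (1 - n%:R^-1) ^+ t) ^+ 2 - n%:R * (n%:R - 1) * (1 - 2 / n%:R) ^+ t.
Proof.
move=> szr n_gt1 rsE; rewrite -(iter_coupon_op_sum_roots szr rsE).
have n2 : n.-2.+2 = n by case: (n) n_gt1 => [|[]].
apply/eqP; rewrite eq_sym subr_eq addrC -subr_eq; apply/eqP.
rewrite -(@coef_prod_XsubC_subsubleading _ _ n.-2) ?n2 // -rsE.
rewrite coef_iter_coupon_op -mulrnAr coupon_basisE.
rewrite coef_prod_XsubC_subsubleading; last by rewrite size_nseq n2.
rewrite !big_nseq expr1n !iter_addr_0 -subn2 natrB // mulrBl divff //.
by ring.
Qed.

End CouponPolynomial.

(** * The coupon collector lower tail *)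

(** By the mean value theorem on [[0, x]]. It serves to integrate each Taylor bound of the
    exponential into the next one. *)
Lemma ge0_of_derive (R : realType) (f df : R -> R) :
  (forall x : R, is_derive x (1 : R) f (df x)) ->
  (forall x : R, 0 <= x -> 0 <= df x) ->
  0 <= f 0 -> forall x : R, 0 <= x -> 0 <= f x.
Proof.
move=> f_df df_ge0 f0 x x0.
have f_cont : {within `[0, x], continuous f}%classic.
  apply: continuous_subspaceT => y.
  by apply: differentiable_continuous; apply/derivable1_diffP; case: (f_df y).
have [y] := MVT_segment x0 (fun y _ => f_df y) f_cont.
rewrite in_itv /= subr0 => /andP[y0 _] fE.
by have := mulr_ge0 (df_ge0 y y0) x0; rewrite -fE; lra.
Qed.

(** * Taylor bounds for the exponential *)

Section ExpBounds.
Variable R : realType.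
Implicit Type x : R.

Lemma expR_ge_quadratic x : 0 <= x -> 1 + x + x ^+ 2 / 2 <= expR x.
Proof.
move=> x0; rewrite -subr_ge0.
apply: (@ge0_of_derive R (fun x => expR x - (1 + x + x ^+ 2 / 2))
  (fun x => expR x - (1 + x))) => [y|y _||//].
- apply: is_derive_eq; rewrite /GRing.scale /=; lra.
- by rewrite subr_ge0 expR_ge1Dx.
- by rewrite expR0; lra.
Qed.

Lemma expR_ge_cubic x : 0 <= x -> 1 + x + x ^+ 2 / 2 + x ^+ 3 / 6 <= expR x.
Proof.
move=> x0; rewrite -subr_ge0.
apply: (@ge0_of_derive R (fun x => expR x - (1 + x + x ^+ 2 / 2 + x ^+ 3 / 6))
  (fun x => expR x - (1 + x + x ^+ 2 / 2))) => [y|y y0||//].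
- apply: is_derive_eq; rewrite /GRing.scale /=; lra.
- by rewrite subr_ge0 expR_ge_quadratic.
- by rewrite expR0; lra.
Qed.

Lemma expRN_le_quadratic x : 0 <= x -> expR (- x) <= 1 - x + x ^+ 2 / 2.
Proof.
move=> x0; rewrite -subr_ge0.
apply: (@ge0_of_derive R (fun x => 1 - x + x ^+ 2 / 2 - expR (- x))
  (fun x => expR (- x) - (1 - x))) => [y|y y0||//].
- apply: is_derive_eq; rewrite /GRing.scale /=; lra.
- by rewrite subr_ge0 expR_ge1Dx.
- by rewrite oppr0 expR0; lra.
Qed.

Lemma expRN_ge_cubic x : 0 <= x ->
  1 - x + x ^+ 2 / 2 - x ^+ 3 / 6 <= expR (- x).
Proof.
move=> x0; rewrite -subr_ge0.
apply: (@ge0_of_derive R (fun x => expR (- x) - (1 - x + x ^+ 2 / 2 - x ^+ 3 / 6))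
  (fun x => 1 - x + x ^+ 2 / 2 - expR (- x))) => [y|y y0||//].
- apply: is_derive_eq; rewrite /GRing.scale /=; lra.
- by rewrite subr_ge0 expRN_le_quadratic.
- by rewrite oppr0 expR0; lra.
Qed.

Lemma oneminus_le_expR x : 0 <= x <= 1 -> 1 - x <= expR (- (x + x ^+ 2 / 2)).
Proof.
move=> /andP[x0 x1]; set y := x + x ^+ 2 / 2.
have y0 : 0 <= y by rewrite /y; nra.
apply: le_trans (expRN_ge_cubic y0); rewrite -subr_ge0.
(* The bracket is at least 16 - 13 on [0, 1]. *)
have -> : 1 - y + y ^+ 2 / 2 - y ^+ 3 / 6 - (1 - x) =
  x ^+ 3 * (16 - 6 * x - 6 * x ^+ 2 - x ^+ 3) / 48 by rewrite /y; field.
have x2 : x ^+ 2 <= 1 by rewrite exprn_ile1.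
have x3 : x ^+ 3 <= 1 by rewrite exprn_ile1.
by rewrite divr_ge0 // mulr_ge0 ?exprn_ge0 //; lra.
Qed.

(** The coefficient 3/8 exceeds 1/3, the cubic Taylor coefficient of [- ln (1 - x)], and the excess
    absorbs the higher terms on this range. It is applied to [x = 1 / n] with [n >= 13]. *)
Lemma expR_le_oneminus x : 0 <= x <= 13^-1 ->
  expR (- (x + x ^+ 2 / 2 + 3 / 8 * x ^+ 3)) <= 1 - x.
Proof.
move=> /andP[x0 x1].
have [y yE] : exists y, y = x + x ^+ 2 / 2 + 3 / 8 * x ^+ 3 by eexists.
rewrite -yE.
have y0 : 0 <= y by rewrite yE !addr_ge0 ?mulr_ge0 ?exprn_ge0 //; lra.
have x_lt1 : 0 < 1 - x by lra.
rewrite expRN -[leRHS]invrK lef_pV2 ?posrE ?expR_gt0 ?invr_gt0 //.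
apply: le_trans (expR_ge_cubic y0).
rewrite -div1r ler_pdivrMr // -subr_ge0.
have x2 : 0 <= x ^+ 2 by rewrite exprn_ge0.
have x3 : 0 <= x ^+ 3 by rewrite exprn_ge0.
have y_ge : 0 <= x + x ^+ 2 / 2 <= y by rewrite yE; lra.
have y2 : x ^+ 2 + x ^+ 3 + x ^+ 4 <= y ^+ 2.
  rewrite -subr_ge0 [leRHS](_ : _ = x ^+ 5 * (3 / 8) + 9 / 64 * x ^+ 6); last first.
    by rewrite yE; field.
  by rewrite addr_ge0 ?mulr_ge0 ?exprn_ge0 //; lra.
have y3 : x ^+ 3 + 3 / 2 * x ^+ 4 <= y ^+ 3.
  apply: (@le_trans _ _ ((x + x ^+ 2 / 2) ^+ 3)); last first.
    by case/andP: y_ge => ? ?; rewrite lerXn2r ?nnegrE.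
  rewrite -subr_ge0 [leRHS](_ : _ = x ^+ 5 * (3 / 4) + 8^-1 * x ^+ 6); last by field.
  by rewrite addr_ge0 ?mulr_ge0 ?exprn_ge0 //; lra.
(* 25/24 = 3/8 + 1/2 + 1/6 and 3/4 = 1/2 + 1/4 collect the cubic and quartic terms of [y],
   [y ^+ 2 / 2] and [y ^+ 3 / 6]. *)
have {y2 y3} : 1 + x + x ^+ 2 + 25 / 24 * x ^+ 3 + 3 / 4 * x ^+ 4 <=
    1 + y + y ^+ 2 / 2 + y ^+ 3 / 6.
  by lra.
rewrite -(ler_pM2r x_lt1) -(lerD2r (- 1)); apply: le_trans.
rewrite [leRHS](_ : _ = x ^+ 3 * (1 / 24 - 7 / 24 * x - 3 / 4 * x ^+ 2)); last by field.
by rewrite mulr_ge0 //; nra.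
Qed.
End ExpBounds.

(** * Comparison of exponents for large n *)

Section CouponExponent.
Variable R : realType.

(* With [L = t / N]: [exp (- L - z)] and [a^2 exp (- y)] will be bounds for
   [a = (1 - 1 / N)^t] and [(1 - 2 / N)^t], and [16 L^2 <= 9 N] comes from
   [exp L <= N]. *)
Lemma coupon_poly_ineq (N L z y : R) :
  13 <= N -> 0 <= L -> 16 * L ^+ 2 <= 9 * N ->
  z = L / (2 * N) + 3 * L / (8 * N ^+ 2) -> y = N * L / (N - 1) ^+ 2 ->
  0 <= 1 - 2 * z /\
  2 * N * (z - z ^+ 2 / 2 + z ^+ 3 / 6)
    <= (1 - 2 * z) * (1 + (N - 1) * (y - y ^+ 2 / 2)).
Proof.
move=> N13 L0 LN def_z def_y; have N0 : 0 < N by lra. have M0 : 0 < N - 1 by lra.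
have [w wE] : exists w, w = N^-1 by eexists.
have [v vE] : exists v, v = (N - 1)^-1 by eexists.
(* Both sides are rewritten in [X], [Y], [w] and [v], which have numerical bounds; the remaining
   terms [L] cancel. *)
have [X XE] : exists X, X = L ^+ 2 / N by eexists.
have [Y YE] : exists Y, Y = L / N by eexists.
have w0 : 0 < w by rewrite wE invr_gt0.
have w13 : w <= 13^-1 by rewrite wE lef_pV2 ?posrE //; lra.
have v12 : v <= 12^-1 by rewrite vE lef_pV2 ?posrE //; lra.
have wv : w <= v by rewrite wE vE lef_pV2 ?posrE //; lra.
have X0 : 0 <= X by rewrite XE divr_ge0 ?sqr_ge0 // ltW.
have Y0 : 0 <= Y by rewrite YE divr_ge0 // ltW.
have X_le : X <= 9 / 16 by rewrite XE ler_pdivrMr //; lra.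
have Y2 : Y ^+ 2 = X * w by rewrite YE XE wE; field; rewrite gt_eqF.
have Y_le : Y <= 21 / 100.
  have: Y ^+ 2 <= (21 / 100) ^+ 2 by rewrite Y2; nra.
  by rewrite ler_pXn2r ?nnegrE //; lra.
have zE : 2 * z = Y * (1 + 3 / 4 * w) by rewrite def_z YE wE; field; rewrite gt_eqF.
have z1 : 0 <= 1 - 2 * z by rewrite zE; nra.
split=> //.
(* 159/250 is just above (13/12)^3 / 2, where 13/12 bounds [1 + v]. *)
have B_ge : 1 + L + Y - 159 / 250 * X <= 1 + (N - 1) * (y - y ^+ 2 / 2).
  have -> : (N - 1) * (y - y ^+ 2 / 2) = L + L * v - X * (1 + v) ^+ 3 / 2.
    by rewrite def_y XE vE; field; rewrite !gt_eqF.
  have Lv : Y <= L * v by rewrite YE -wE ler_wpM2l.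
  have v3 : (1 + v) ^+ 3 <= (13 / 12) ^+ 3 by rewrite lerXn2r ?nnegrE //; lra.
  have := ler_wpM2l X0 v3; lra.
apply: le_trans (ler_wpM2l z1 B_ge).
have -> : 2 * N * (z - z ^+ 2 / 2 + z ^+ 3 / 6) =
  L + 3 / 4 * Y - X * (1 + 3 / 4 * w) ^+ 2 / 4 + X * Y * (1 + 3 / 4 * w) ^+ 3 / 24.
  by rewrite def_z XE YE wE; field; rewrite gt_eqF.
have [s sE] : exists s, s = 1 + 3 / 4 * w by eexists.
rewrite zE -sE.
have s1 : 1 <= s by rewrite sE; lra.
have s2 : s <= 55 / 52 by rewrite sE; lra.
have YL : Y * L = X by rewrite YE XE; field; rewrite gt_eqF.
have -> : (1 - Y * s) * (1 + L + Y - 159 / 250 * X) =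
  1 + L + Y - 159 / 250 * X - s * (Y + X + X * w - 159 / 250 * (X * Y)).
  by rewrite -[in RHS]Y2 -[X in s * (_ + X + _ - _)]YL; ring.
have t1 : s * (Y + X + X * w - 159 / 250 * (X * Y)) <=
   55 / 52 * (Y + 14 / 13 * X) - 159 / 250 * (X * Y) by nra.
have t2 : X <= X * s ^+ 2 by rewrite ler_peMr // exprn_ege1.
have t3 : X * Y * s ^+ 3 <= X * Y * (55 / 52) ^+ 3.
  by apply: ler_wpM2l; rewrite ?mulr_ge0 // lerXn2r ?nnegrE //; lra.
(* The net coefficient of [X * Y] is positive, so the final linear step needs this lower bound on
   the product. *)
have t4 : 0 <= (9 / 16 - X) * (21 / 100 - Y) by rewrite mulr_ge0 // subr_ge0.
lra.
Qed.

(** From [e >= 8/3] and [L / 2 <= exp (L / 2 - 1)] one gets [exp (L / 2) >= 4 L / 3], which is then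
    squared. *)
Lemma sqr_le_expR (L : R) : 0 <= L -> 16 / 9 * L ^+ 2 <= expR L.
Proof.
move=> L0; have e1 : 8 / 3 <= expR 1 :> R.
  by apply: le_trans (expR_ge_cubic ler01); lra.
have e2 : L / 2 <= expR (L / 2 - 1) by apply: le_trans (expR_ge1Dx _); lra.
have e3 : 4 / 3 * L <= expR (L / 2).
  rewrite -[L / 2](subrKC 1) expRD.
  apply: (@le_trans _ _ (8 / 3 * (L / 2))); first lra.
  by rewrite ler_pM //; lra.
rewrite [L in expR L](splitr L) expRD -expr2.
have -> : 16 / 9 * L ^+ 2 = (4 / 3 * L) ^+ 2 by field.
by rewrite lerXn2r ?nnegrE ?expR_ge0 //; lra.
Qed.

(** The right-hand side is the sum of all [p_i + p_i^2 / 2] over the roots, divided by [n]. *)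
Lemma coupon_exponent_large (n t : nat) : (13 <= n)%N ->
  n%:R^-1 <= expR (- (t%:R / n%:R)) :> R ->
  expR (- (t%:R / n%:R)) <= (1 - n%:R^-1) ^+ t +
    (n%:R * ((1 - n%:R^-1) ^+ t) ^+ 2 - (n%:R - 1) * (1 - 2 / n%:R) ^+ t) / 2 :> R.
Proof.
move=> n13; have [N NE] : exists N : R, N = n%:R by eexists.
rewrite -NE; have [L LE] : exists L : R, L = t%:R / N by eexists.
rewrite -LE; set a := (1 - N^-1) ^+ t => qN.
have N13 : 13 <= N by rewrite NE ler_nat.
have N0 : 0 < N by lra. have M0 : 0 < N - 1 by lra.
have L0 : 0 <= L by rewrite LE divr_ge0 // ltW.
have LN : 16 * L ^+ 2 <= 9 * N.
  have : expR L <= N.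
    by rewrite -[N]invrK -[expR L]invrK -expRN lef_pV2 ?posrE ?expR_gt0 ?invr_gt0.
  by have := sqr_le_expR L0; lra.
pose z := L / (2 * N) + 3 * L / (8 * N ^+ 2); pose y := N * L / (N - 1) ^+ 2.
have [z1 ineq] := coupon_poly_ineq N13 L0 LN (erefl z) (erefl y).
have z0 : 0 <= z.
  by apply: addr_ge0; apply: divr_ge0; rewrite ?mulr_ge0 ?exprn_ge0 //; lra.
have y0 : 0 <= y by rewrite divr_ge0 ?mulr_ge0 ?exprn_ge0 //; lra.
have a_ge : expR (- L) * expR (- z) <= a.
  rewrite -expRD.
  have -> : - L - z = t%:R * - (N^-1 + N^-1 ^+ 2 / 2 + 3 / 8 * N^-1 ^+ 3).
    by rewrite /z LE; field; rewrite gt_eqF.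
  rewrite expRM_natl; have Ni : 0 <= N^-1 <= 13^-1.
    by rewrite invr_ge0 ltW //= lef_pV2 ?posrE //; lra.
  have := expR_le_oneminus Ni => le1.
  by rewrite /a lerXn2r ?nnegrE ?expR_ge0 //; apply: le_trans le1; apply: expR_ge0.
(* The factor by which [1 - 2 / N] falls short of [(1 - 1 / N)^2] is [1 - 1 / (N - 1)^2], and
   [y = t / (N - 1)^2]. *)
have b_le : (1 - 2 / N) ^+ t <= a ^+ 2 * expR (- y).
  have -> : 1 - 2 / N = (1 - N^-1) ^+ 2 * (1 - (N - 1)^-1 ^+ 2).
    by field; rewrite !gt_eqF.
  rewrite exprMn exprAC -/a; apply: ler_wpM2l; first exact: sqr_ge0.
  have -> : - y = t%:R * - (N - 1)^-1 ^+ 2 by rewrite /y LE; field; rewrite !gt_eqF.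
  rewrite expRM_natl lerXn2r ?nnegrE ?expR_ge0 //; last exact: expR_ge1Dx.
  by rewrite subr_ge0 exprn_ile1 ?invr_ge0 ?invf_le1 //; lra.
have q0 : 0 < expR (- L) by apply: expR_gt0.
move: qN q0 a_ge; set q := expR (- L) => qN q0 a_ge.
have rho0 : 0 < expR (- z) by apply: expR_gt0.
have rho1 := expRN_ge_cubic z0.
have rho2 : 1 - 2 * z <= expR (- z) ^+ 2.
  by rewrite -expRM_natl; apply: le_trans (expR_ge1Dx _); lra.
have ey := expRN_le_quadratic y0.
have ey1 : expR (- y) <= 1 by rewrite -expR0 ler_expR; lra.
move: (expR (- z)) (expR (- y)) rho0 rho1 rho2 ey ey1 a_ge b_le.
move=> r e r0 r1 r2 ey ey1 a_ge b_le.
have a0 : 0 <= a by apply: le_trans a_ge; rewrite mulr_ge0 // ltW.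
have K0 : 1 <= 1 + (N - 1) * (1 - e) by nra.
have bN : (N - 1) * (1 - 2 / N) ^+ t <= (N - 1) * (a ^+ 2 * e) by rewrite ler_pM2l.
have step1 : a + a ^+ 2 * (1 + (N - 1) * (1 - e)) / 2 <=
    a + (N * a ^+ 2 - (N - 1) * (1 - 2 / N) ^+ t) / 2.
  by move: bN; nra.
apply: le_trans step1.
have qr0 : 0 <= q * r by rewrite mulr_ge0 // ltW.
have a2 : (q * r) ^+ 2 <= a ^+ 2 by rewrite lerXn2r ?nnegrE.
have a2K := ler_wpM2r (le_trans ler01 K0) a2.
suff : q <= q * r + (q * r) ^+ 2 * (1 + (N - 1) * (1 - e)) / 2 by lra.
have Nq : 1 <= N * q by rewrite -(ler_pM2l N0) mulfV ?gt_eqF // in qN.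
have K1 : 1 + (N - 1) * (y - y ^+ 2 / 2) <= 1 + (N - 1) * (1 - e).
  by rewrite lerD2l ler_pM2l //; lra.
(* Since [N q >= 1], one factor [q] of the quadratic term is worth at least [1 / N]. The goal thus
   reduces to this inequality, free of [q]. *)
have main : 2 * N * (1 - r) <= r ^+ 2 * (1 + (N - 1) * (1 - e)).
  apply: (@le_trans _ _ (2 * N * (z - z ^+ 2 / 2 + z ^+ 3 / 6))).
    by rewrite ler_pM2l; lra.
  apply: le_trans ineq _.
  apply: (@le_trans _ _ ((1 - 2 * z) * (1 + (N - 1) * (1 - e)))).
    exact: ler_wpM2l.
  by apply: ler_wpM2r => //; lra.
have h : N * q * (q * (r ^+ 2 * (1 + (N - 1) * (1 - e)))) >= q * (2 * N * (1 - r)).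
  apply: le_trans (ler_wpM2l (ltW q0) main) _.
  apply: ler_peMl => //; apply: mulr_ge0; first exact: ltW.
  by apply: mulr_ge0; rewrite ?sqr_ge0 // (le_trans ler01 K0).
by rewrite -(ler_pM2l N0); lra.
Qed.
End CouponExponent.

(** * Small n: evaluation with binary integers *)

Section BinaryEvaluation.

Fixpoint Npow (a : N) (k : nat) : N :=
  if k is j.+1 then N.mul a (Npow a j) else 1%num.

Lemma natr_Nadd (R : pzSemiRingType) (a b : N) :
  (N.to_nat (N.add a b))%:R = (N.to_nat a)%:R + (N.to_nat b)%:R :> R.
Proof. by rewrite N2Nat.inj_add natrD. Qed.

Lemma natr_Nmul (R : pzSemiRingType) (a b : N) :
  (N.to_nat (N.mul a b))%:R = (N.to_nat a)%:R * (N.to_nat b)%:R :> R.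
Proof. by rewrite N2Nat.inj_mul natrM. Qed.

Lemma natr_Npow (R : pzSemiRingType) (a : N) (k : nat) :
  (N.to_nat (Npow a k))%:R = (N.to_nat a)%:R ^+ k :> R.
Proof. by elim: k => [|k IHk] //=; rewrite natr_Nmul IHk exprS. Qed.

Lemma natr_Nle (R : realDomainType) (a b : N) :
  ((N.to_nat a)%:R <= (N.to_nat b)%:R :> R) = N.leb a b.
Proof.
apply/idP/idP => [|/N.leb_le/N.sub_add <-]; last by rewrite natr_Nadd lerDr ler0n.
apply: contraTT => /negbTE/N.leb_gt/N.le_succ_l/N.sub_add <-.
by rewrite -N.add_1_l !natr_Nadd -ltNge addrA ltrDr ltr_wpDl.
Qed.

(* [expR (n%:R^-1) >= e / c], so the test on [e ^ t / c ^ t] is implied by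
   [expR (t / n) <= n]. *)
Definition coupon_check (n : N) (t : nat) : bool :=
  let c := N.mul 6%num (Npow n 3) in
  let e := N.add c (N.add (N.mul 6%num (Npow n 2)) (N.add (N.mul 3%num n) 1%num)) in
  let ct := Npow c t in let et := Npow e t in
  if N.leb et (N.mul n ct) then
    let n1 := N.pred n in
    let A := Npow n1 t in
    let B := Npow (N.pred n1) t in
    let P := Npow n t in
    N.leb (N.add (N.mul (N.mul 2%num (N.mul P P)) ct)
                 (N.mul (N.mul n1 (N.mul B P)) et))
      (N.mul (N.add (N.mul 2%num (N.mul A P)) (N.mul n (N.mul A A))) et)
  else true.

(** The range [t < 3 n] suffices: for [t >= 3 n], [sqr_le_expR] gives [exp (t / n) >= 16], which
    exceeds every [n <= 12]. *)
Lemma coupon_check_small :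
  all (fun n => all (coupon_check (N.of_nat n)) (iota 0 (3 * n))) (iota 2 11).
Proof. by vm_compute. Qed.
End BinaryEvaluation.

(** * The bound on the probability of a complete collection *)

Section CouponBound.
Variable R : realType.

Lemma coupon_exponent_small (n t : nat) : (2 <= n <= 12)%N ->
  n%:R^-1 <= expR (- (t%:R / n%:R)) :> R ->
  expR (- (t%:R / n%:R)) <= (1 - n%:R^-1) ^+ t +
    (n%:R * ((1 - n%:R^-1) ^+ t) ^+ 2 - (n%:R - 1) * (1 - 2 / n%:R) ^+ t) / 2 :> R.
Proof.
move=> /andP[n2 n12].
have [N NE] : exists N : R, N = n%:R by eexists.
rewrite -NE => qN.
have N2 : 2 <= N by rewrite NE ler_nat.
have N12 : N <= 12 by rewrite NE ler_nat.
have N0 : 0 < N by lra.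
have eN : expR (t%:R / N) <= N.
  by rewrite -[N in leRHS]invrK -[expR _]invrK -expRN lef_pV2 ?posrE ?expR_gt0 ?invr_gt0.
have t_lt : (t < 3 * n)%N.
  rewrite ltnNge; apply/negP; rewrite -(ler_nat R) natrM -NE -ler_pdivlMr // => L3.
  have L0 : 0 <= t%:R / N by rewrite divr_ge0 // ltW.
  have := sqr_le_expR L0.
  have : 3 ^+ 2 <= (t%:R / N) ^+ 2 by rewrite lerXn2r ?nnegrE.
  by lra.
have := coupon_check_small => /allP/(_ n).
rewrite mem_iota n2 /= => /(_ n12)/allP/(_ t).
rewrite mem_iota /= => /(_ t_lt).
(* [e / c] is the cubic Taylor polynomial of the exponential at [1 / N], over a common
   denominator. *)
have [c cE] : exists c : R, c = 6 * N ^+ 3 by eexists.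
have [e eE] : exists e : R, e = c + (6 * N ^+ 2 + (3 * N + 1)) by eexists.
have c0 : 0 < c by rewrite cE mulr_gt0 // exprn_gt0.
have e0 : 0 < e by rewrite eE; nra.
have ec : e / c <= expR N^-1.
  have Ni : 0 <= N^-1 by rewrite invr_ge0 ltW.
  apply: le_trans (expR_ge_cubic Ni); rewrite eE cE.
  by rewrite le_eqVlt; apply/orP; left; apply/eqP; field; rewrite gt_eqF.
have ect : e ^+ t / c ^+ t <= expR (t%:R / N).
  rewrite expRM_natl -expr_div_n lerXn2r ?nnegrE ?expR_ge0 //.
  by rewrite divr_ge0 // ltW.
have ct0 : 0 < c ^+ t by rewrite exprn_gt0.
have et0 : 0 < e ^+ t by rewrite exprn_gt0.
have n1E : N.pred (N.of_nat n) = N.of_nat n.-1 by rewrite Nat2N.inj_pred.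
have n2E : N.pred (N.of_nat n.-1) = N.of_nat n.-2 by rewrite [RHS]Nat2N.inj_pred.
rewrite /coupon_check n1E n2E -!(natr_Nle R).
rewrite !(natr_Nadd, natr_Nmul, natr_Npow) !Nat2N.id -NE.
have -> : n.-1%:R = N - 1 :> R by rewrite -subn1 natrB ?NE // ltnW.
have -> : n.-2%:R = N - 2 :> R by rewrite -subn2 natrB ?NE.
have toN : (N.to_nat 6 = 6) * (N.to_nat 3 = 3) * (N.to_nat 2 = 2) *
  (N.to_nat 1 = 1) by [].
rewrite !toN.
rewrite -cE -eE.
have -> : e ^+ t <= N * c ^+ t by rewrite -ler_pdivrMr // (le_trans ect eN).
set P := N ^+ t; set A := (N - 1) ^+ t; set B := (N - 2) ^+ t => chk.
have P0 : 0 < P by rewrite exprn_gt0.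
have -> : (1 - N^-1) ^+ t = A / P.
  by rewrite -expr_div_n; congr (_ ^+ _); field; rewrite gt_eqF.
have -> : (1 - 2 / N) ^+ t = B / P.
  by rewrite -expr_div_n; congr (_ ^+ _); field; rewrite gt_eqF.
(* A rational upper bound replaces the exponential; multiplying by [2 * (P * P) * e ^+ t] then
   yields the inequality checked on integers. *)
apply: (@le_trans _ _ (c ^+ t / e ^+ t)).
  by rewrite expRN -[leRHS]invrK lef_pV2 ?posrE ?expR_gt0 ?invr_gt0 ?divr_gt0 // invf_div.
rewrite ler_pdivrMr // -(ler_pM2l (_ : 0 < 2 * (P * P))) ?mulr_gt0 //.
rewrite [leRHS](_ : _ = (2 * (A * P) + N * (A * A)) * e ^+ t -
    (N - 1) * (B * P) * e ^+ t); last first.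
  by field; rewrite gt_eqF.
by rewrite lerBrDr.
Qed.

Lemma coupon_exponent (n t : nat) : (2 <= n)%N ->
  n%:R^-1 <= expR (- (t%:R / n%:R)) :> R ->
  n%:R * expR (- (t%:R / n%:R)) <= n%:R * (1 - n%:R^-1) ^+ t +
    ((n%:R * (1 - n%:R^-1) ^+ t) ^+ 2
     - n%:R * (n%:R - 1) * (1 - 2 / n%:R) ^+ t) / 2 :> R.
Proof.
move=> n2 qN.
have H : expR (- (t%:R / n%:R)) <= (1 - n%:R^-1) ^+ t +
    (n%:R * ((1 - n%:R^-1) ^+ t) ^+ 2 - (n%:R - 1) * (1 - 2 / n%:R) ^+ t) / 2 :> R.
  have [n12|n12] := leqP n 12; first by apply: coupon_exponent_small; rewrite ?n2.
  exact: coupon_exponent_large.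
apply: le_trans (ler_wpM2l (ler0n _ n) H) _.
by rewrite le_eqVlt; apply/orP; left; apply/eqP; ring.
Qed.

Lemma coupon_prob_le (n t : nat) : (2 <= n)%N ->
  n%:R^-1 <= expR (- (t%:R / n%:R)) :> R ->
  coupon_prob R n t n <= expR (- (n%:R * expR (- (t%:R / n%:R)))).
Proof.
move=> n2 qN; have n0 : (0 < n)%N by rewrite ltnW.
have [rs [szr rs01 rsE]] := iter_coupon_op_roots R n0 t.
rewrite /coupon_prob rsE horner_prod.
apply: (@le_trans _ _ (\prod_(z <- rs) expR (- (z + z ^+ 2 / 2)))).
  rewrite !big_seq; apply: ler_prod => z /rs01 z01.
  rewrite hornerXsubC oneminus_le_expR // andbT.
  by rewrite subr_ge0; case/andP: z01.
rewrite -expR_sum ler_expR sumrN lerN2 big_split /= -mulr_suml.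
rewrite (iter_coupon_op_sum_roots n0 szr rsE).
rewrite (iter_coupon_op_sum_sqr_roots n0 szr n2 rsE).
exact: coupon_exponent.
Qed.
End CouponBound.

(** * Glauber dynamics *)

(* Layer-cake argument: subtract from [psi] multiples of indicators of up-sets
   until its support is empty. *)
Lemma upset_sum_ge0 (R : realDomainType) (d : Order.disp_t) (S : finOrderType d)
    (delta psi : S -> R) :
  (forall s, 0 <= \sum_(r | (s <= r)%O) delta r) ->
  (forall s, 0 <= psi s) -> {homo psi : r s / (r <= s)%O >-> r <= s} ->
  0 <= \sum_s delta s * psi s.
Proof.
move=> delta_ge0; have [m] := ubnP #|[set s | 0 < psi s]|.
elim: m psi => [//|m IHm] psi psi_m psi_ge0 psi_homo.
have [s1 s1_gt0|psi_le0] := pickP (fun s => 0 < psi s); last first.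
  rewrite big1 // => s _; suff -> : psi s = 0 by rewrite mulr0.
  by apply/eqP; rewrite eq_le psi_ge0 andbT leNgt psi_le0.
case: (@arg_minP _ _ _ s1 (fun s => 0 < psi s) (fun s : S => s) s1_gt0).
move=> s0 s0_gt0 s0_min.
have psi_le0 s : ~~ (s0 <= s)%O -> psi s = 0.
  move=> s0s; apply/eqP; rewrite eq_le psi_ge0 andbT leNgt.
  by apply: contra s0s => /s0_min.
pose phi s := if (s0 <= s)%O then psi s - psi s0 else 0.
have -> : \sum_s delta s * psi s =
    \sum_s delta s * phi s + psi s0 * \sum_(r | (s0 <= r)%O) delta r.
  rewrite mulr_sumr [X in _ + X]big_mkcond -big_split /=; apply: eq_bigr => s _.
  by rewrite /phi; case: ifPn => [_|/psi_le0 ->]; ring.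
apply: addr_ge0; last exact: mulr_ge0.
apply: IHm.
- rewrite -ltnS; apply: leq_trans psi_m; rewrite ltnS; apply: proper_card.
  apply/properP; split; last by exists s0; rewrite !inE ?s0_gt0 // /phi lexx subrr ltxx.
  apply/fintype.subsetP => s; rewrite !inE /phi; case: ifPn => _; last by rewrite ltxx.
  by rewrite subr_gt0; apply: lt_trans.
- by move=> s; rewrite /phi; case: ifPn => // /psi_homo; rewrite subr_ge0.
- move=> r s rs; rewrite /phi; case: ifPn => [s0r|_].
    by rewrite (le_trans s0r rs) lerD2r psi_homo.
  by case: ifPn => // /psi_homo; rewrite subr_ge0.
Qed.

(** [upset_sum_ge0] is applied to [M - phi], nonnegative and increasing for a large constant [M],
    which drops out because the masses agree. *)
Lemma stoch_dominates_antimono (R : realType) (d : Order.disp_t)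
    (S : finOrderType d) (nu mu phi : S -> R) :
  stoch_dominates nu mu -> \sum_s nu s = \sum_s mu s ->
  {homo phi : r s / (r <= s)%O >-> s <= r} ->
  \sum_s nu s * phi s <= \sum_s mu s * phi s.
Proof.
move=> nu_mu mass phi_homo; pose M := \sum_s `|phi s|.
have : 0 <= \sum_s (nu s - mu s) * (M - phi s).
  apply: upset_sum_ge0 => [s|s|r s /phi_homo rs]; last by rewrite lerD2l lerN2.
  - by rewrite sumrB subr_ge0; apply: nu_mu.
  - rewrite subr_ge0 /M (bigD1 s) //= (le_trans (ler_norm _)) // lerDl.
    exact: sumr_ge0.
rewrite (eq_bigr (fun s => (nu s - mu s) * M +
    (mu s * phi s - nu s * phi s))); last first.
  by move=> s _; ring.
by rewrite big_split /= -mulr_suml !sumrB mass subrr mul0r add0r subr_ge0.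
Qed.

(** * Glauber dynamics as an operator on functions; reversibility *)

Section Glauber.
Context {R : realType} {d : Order.disp_t} {S : finOrderType d} {V : finType}.
Variable pi : config S V -> R.
Hypothesis pi_gt0 : forall x, 0 < pi x.

Implicit Types (x y z : config S V) (f h : config S V -> R) (u v : V) (r s : S).

Lemma upd_upd x u r s : upd (upd x u r) u s = upd x u s.
Proof. by apply/ffunP => v; rewrite !ffunE; case: eqP. Qed.

Lemma upd_id x u : upd x u (x u) = x.
Proof. by apply/ffunP => v; rewrite !ffunE; case: eqP => // ->. Qed.

Lemma upd_inj x u : injective (upd x u).
Proof. by move=> r s /ffunP/(_ u); rewrite !ffunE eqxx. Qed.

Lemma upd_set_upd x u s : upd_set (upd x u s) u = upd_set x u.
Proof. by apply: eq_imset => r; rewrite upd_upd. Qed.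

Lemma mem_upd_set x y u : (y \in upd_set x u) = (x \in upd_set y u).
Proof.
by apply/imsetP/imsetP => -[s _ ->]; [exists (x u)|exists (y u)];
  rewrite // upd_upd upd_id.
Qed.

Lemma upd_set_eq x y u : y \in upd_set x u -> upd_set y u = upd_set x u.
Proof. by case/imsetP => s _ ->; rewrite upd_set_upd. Qed.

Lemma sum_upd_set x u h : \sum_(y in upd_set x u) h y = \sum_s h (upd x u s).
Proof. by rewrite big_imset //= => r s _ _; apply: upd_inj. Qed.

Lemma upd_measure_gt0 x u : 0 < measure_of pi (upd_set x u).
Proof.
rewrite /measure_of (bigD1 x) /=; last first.
  by apply/imsetP; exists (x u) => //; rewrite upd_id.
by apply: ltr_pwDl => //; apply: sumr_ge0 => y _; apply: ltW.
Qed.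

Lemma cond_spin_gt0 x u s : 0 < cond_spin pi x u s.
Proof. by rewrite divr_gt0 ?upd_measure_gt0. Qed.

Lemma sum_cond_spin x u : \sum_s cond_spin pi x u s = 1.
Proof.
rewrite -mulr_suml -(sum_upd_set x u pi) divff // gt_eqF //.
exact: upd_measure_gt0.
Qed.

(** The conditional expectation of [h] under [pi] given the spins at all sites other than [u]. *)
Definition site_op u h x : R := \sum_s cond_spin pi x u s * h (upd x u s).

Definition glauber_op h x : R := #|V|%:R^-1 * \sum_u site_op u h x.

Lemma site_opE u h x : site_op u h x =
  \sum_(y in upd_set x u) pi y / measure_of pi (upd_set x u) * h y.
Proof. by rewrite sum_upd_set. Qed.

Lemma site_op_cst u (a : R) x : site_op u (fun=> a) x = a.
Proof. by rewrite /site_op -mulr_suml sum_cond_spin mul1r. Qed.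

(** Configurations that agree off [u] share the same [upd_set], so the kernel [pi x * pi y /
    measure_of pi (upd_set x u)] is symmetric. *)
Lemma site_op_sym u f h :
  \sum_x pi x * f x * site_op u h x = \sum_x pi x * h x * site_op u f x.
Proof.
under eq_bigr => x _ do rewrite site_opE mulr_sumr.
under [RHS]eq_bigr => x _ do rewrite site_opE mulr_sumr.
rewrite (exchange_big_dep predT) //=; apply: eq_bigr => x _.
apply: eq_big => [y|y]; first by rewrite mem_upd_set.
by rewrite mem_upd_set => xy; rewrite (upd_set_eq xy); ring.
Qed.

Lemma site_op_mean u h : \sum_x pi x * site_op u h x = \sum_x pi x * h x.
Proof.
have := site_op_sym u (fun=> 1) h.
under eq_bigr => x _ do rewrite mulr1.
by move=> ->; apply: eq_bigr => x _; rewrite site_op_cst mulr1.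
Qed.

Lemma glauber_op_sym f h :
  \sum_x pi x * f x * glauber_op h x = \sum_x pi x * h x * glauber_op f x.
Proof.
have E f' h' : \sum_x pi x * f' x * glauber_op h' x =
    #|V|%:R^-1 * \sum_u \sum_x pi x * f' x * site_op u h' x.
  rewrite exchange_big mulr_sumr; apply: eq_bigr => x _.
  by rewrite -mulr_sumr /glauber_op; ring.
by rewrite !E; congr (_ * _); apply: eq_bigr => u _; apply: site_op_sym.
Qed.

Lemma iter_glauber_op_sym t f h :
  \sum_x pi x * f x * iter t glauber_op h x =
  \sum_x pi x * h x * iter t glauber_op f x.
Proof.
elim: t f h => [|t IHt] f h; first by apply: eq_bigr => x _ /=; ring.
by rewrite iterSr IHt [in RHS]iterS glauber_op_sym; apply: eq_bigr => x _; ring.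
Qed.

Lemma sum_glauberM h x : \sum_z glauber pi x z * h z = glauber_op h x.
Proof.
rewrite /glauber_op mulr_sumr.
under eq_bigr => z _ do rewrite mulr_suml.
rewrite exchange_big; apply: eq_bigr => u _.
under eq_bigr => z _ do rewrite -mulrA.
rewrite -mulr_sumr; congr (_ * _).
under eq_bigr => z _ do rewrite mulr_suml.
rewrite (exchange_big_dep predT) //=; apply: eq_bigr => s _.
by rewrite (big_pred1 (upd x u s)) // => z; rewrite eq_sym.
Qed.

Lemma glauber_iterE t y :
  (fun x => glauber_iter pi t x y) = iter t (glauber_op) (fun x => (x == y)%:R).
Proof.
elim: t => [//|t IHt] /=; rewrite -IHt; apply/funext => x.
by rewrite sum_glauberM.
Qed.

Lemma glauber_iter_sym t x y :
  pi x * glauber_iter pi t x y = pi y * glauber_iter pi t y x.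
Proof.
have E a b : \sum_z pi z * (z == a)%:R * iter t glauber_op (fun z => (z == b)%:R) z =
    pi a * glauber_iter pi t a b.
  rewrite -glauber_iterE (bigD1 a) //= eqxx mulr1 big1 ?addr0 // => z /negbTE ->.
  by rewrite mulr0 mul0r.
by rewrite -!E iter_glauber_op_sym.
Qed.

Lemma glauber_iterD t1 t2 x y : glauber_iter pi (t1 + t2) x y =
  \sum_z glauber_iter pi t1 x z * glauber_iter pi t2 z y.
Proof.
elim: t1 x => [|t1 IHt] x /=.
  rewrite (bigD1 x) //= eqxx mul1r big1 ?addr0 // => z.
  by rewrite eq_sym => /negbTE ->; rewrite mul0r.
under eq_bigr => z _ do rewrite IHt mulr_sumr.
rewrite exchange_big; apply: eq_bigr => z _ /=.
by rewrite mulr_suml; apply: eq_bigr => w _; rewrite mulrA.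
Qed.

Lemma glauber_ge0 x y : 0 <= glauber pi x y.
Proof.
apply: sumr_ge0 => u _; apply: mulr_ge0; first by rewrite invr_ge0.
by apply: sumr_ge0 => s _; apply/ltW/cond_spin_gt0.
Qed.

Lemma glauber_iter_ge0 t x y : 0 <= glauber_iter pi t x y.
Proof.
elim: t x => [|t IHt] x /=; first by case: eqP.
by apply: sumr_ge0 => z _; rewrite mulr_ge0 ?glauber_ge0.
Qed.

Hypothesis V_gt0 : (0 < #|V|)%N.

Lemma glauber_op_cst (a : R) x : glauber_op (fun=> a) x = a.
Proof.
rewrite /glauber_op; under eq_bigr => u _ do rewrite site_op_cst.
by rewrite sumr_const -[a *+ _]mulr_natl mulKf // pnatr_eq0 -lt0n.
Qed.

Lemma sum_glauber_iter t x : \sum_y glauber_iter pi t x y = 1.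
Proof.
elim: t x => [|t IHt] x /=.
  rewrite (bigD1 x) //= eqxx big1 ?addr0 // => z.
  by rewrite eq_sym => /negbTE ->.
rewrite exchange_big /= -[RHS](glauber_op_cst 1 x) -sum_glauberM.
by apply: eq_bigr => z _; rewrite -mulr_sumr IHt.
Qed.

Lemma glauber_op_avg (F : V -> config S V -> R) x :
  glauber_op (fun x => #|V|%:R^-1 * \sum_u F u x) x =
  #|V|%:R^-1 * \sum_u glauber_op (F u) x.
Proof.
rewrite /glauber_op -mulr_sumr; congr (_ * _).
rewrite [in RHS]exchange_big mulr_sumr; apply: eq_bigr => v _ /=.
rewrite /site_op [in RHS]exchange_big mulr_sumr; apply: eq_bigr => s _ /=.
by rewrite -mulr_sumr mulrCA.
Qed.

(** Linearity, in the form that conditions on the site of the innermost update, the last one in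
    time. *)
Lemma iter_glauber_op_avg t (F : V -> config S V -> R) x :
  iter t glauber_op (fun x => #|V|%:R^-1 * \sum_u F u x) x =
  #|V|%:R^-1 * \sum_u iter t glauber_op (F u) x.
Proof.
elim: t x => [//|t IHt] x; rewrite iterS (funext IHt).
exact: (glauber_op_avg (fun u => iter t glauber_op (F u))).
Qed.

Hypothesis pi_sum1 : \sum_x pi x = 1.
Hypothesis pi_mono : monotone_system pi.

Definition decreasing_config h := forall x y, config_le x y -> h y <= h x.

(** Two moves lead from [y] to [x]: first the spins off [u] are lowered with the law of the new spin
    fixed, then that law is changed by stochastic domination. *)
Lemma site_op_decreasing u h : decreasing_config h -> decreasing_config (site_op u h).
Proof.
move=> h_dec x y xy.
apply: (@le_trans _ _ (\sum_s cond_spin pi y u s * h (upd x u s))).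
  apply: ler_sum => s _; rewrite ler_pM2l ?cond_spin_gt0 //; apply: h_dec => v.
  by rewrite !ffunE; case: eqP.
apply: stoch_dominates_antimono; [exact: pi_mono|by rewrite !sum_cond_spin|].
by move=> r s rs; apply: h_dec => v; rewrite !ffunE; case: eqP.
Qed.

(** * Comparison with the coupon collector *)

Section Coupons.
Variables (bot top : S).
Hypothesis top_max : forall s, (s <= top)%O.
Hypothesis bot_top : bot != top.

(* [A] plays the role of the set of sites not updated yet: an update at [u]
   replaces the support condition on [A] by the one on [A :\ u]. *)
Lemma iter_glauber_op_top_le t (A : {set V}) h :
  decreasing_config h ->
  (forall x v, v \in A -> x v != bot -> h x = 0) ->
  iter t glauber_op h [ffun=> top] <=
  (\sum_x pi x * h x) * coupon_prob R #|V| t #|A|.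
Proof.
elim: t A h => [|t IHt] A h h_dec h_supp.
  rewrite coupon_prob0 ?max_card //=.
  (* If [A] is empty, the value at the top is the minimum of [h], hence at most its mean. Otherwise
     [h] vanishes there because [bot != top]. *)
  have [A0|/finset.set0Pn[v vA]] := eqVneq A finset.set0.
    rewrite A0 cards0 eqxx mulr1 -[leLHS]mul1r -pi_sum1 mulr_suml.
    apply: ler_sum => x _; rewrite ler_pM2l //; apply: h_dec => v.
    by rewrite ffunE.
  have -> : h [ffun=> top] = 0 by apply: (h_supp _ v) => //; rewrite ffunE eq_sym.
  rewrite cards_eq0.
  have /negbTE -> : A != finset.set0 by apply/finset.set0Pn; exists v.
  by rewrite mulr0.
have card_le (B : {set V}) : (#|B| <= #|V|)%N by apply: max_card.
rewrite iterSr [X in iter t _ X](_ : _ = fun x => #|V|%:R^-1 * \sum_u site_op u h x) //.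
rewrite iter_glauber_op_avg coupon_probS //.
set m := \sum_x pi x * h x.
have step u : iter t glauber_op (site_op u h) [ffun=> top] <=
    m * coupon_prob R #|V| t #|A :\ u|.
  rewrite /m -(site_op_mean u h); apply: IHt; first exact: site_op_decreasing.
  move=> x v; rewrite !inE => /andP[vu vA] xv.
  apply: big1 => s _; rewrite (h_supp _ v) ?mulr0 // !ffunE (negbTE vu) //.
apply: (@le_trans _ _ (#|V|%:R^-1 * \sum_u m * coupon_prob R #|V| t #|A :\ u|)).
  by rewrite ler_pM2l ?invr_gt0 ?ltr0n //; apply: ler_sum => u _.
(* Sites in [A] lower the cardinal by one and the others leave it unchanged, which reproduces the
   recursion [coupon_probS]. *)
rewrite (bigID (mem A)) /=.
rewrite (eq_bigr (fun=> m * coupon_prob R #|V| t #|A|.-1)); last first.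
  by move=> u uA; rewrite (cardsD1 u A) uA.
rewrite [X in _ + X](eq_bigr (fun=> m * coupon_prob R #|V| t #|A|)); last first.
  by move=> u uA; rewrite (cardsD1 u A) (negbTE uA).
have sumC (a : R) : \sum_(u | u \notin A) a = a *+ (#|V| - #|A|).
  by rewrite sumr_const -(cardC A) addKn.
rewrite sumr_const sumC -[X in X + _]mulr_natl -[X in _ + X]mulr_natl natrB //.
have V0 : #|V|%:R != 0 :> R by rewrite pnatr_eq0 -lt0n.
by rewrite le_eqVlt; apply/orP; left; apply/eqP; field.
Qed.

(** Here [A] is the whole of [V] and [h] the indicator of the bottom configuration, which is
    decreasing with mean [pi [ffun=> bot]]. *)
Lemma glauber_iter_top_bot_le t : (forall s, (bot <= s)%O) ->
  glauber_iter pi t [ffun=> top] [ffun=> bot] / pi [ffun=> bot] <=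
  coupon_prob R #|V| t #|V|.
Proof.
move=> bot_min; set b : config S V := [ffun=> bot].
set x0 : config S V := [ffun=> top].
rewrite ler_pdivrMr //.
have := @iter_glauber_op_top_le t finset.setT (fun x => (x == b)%:R).
rewrite -glauber_iterE cardsT (bigD1 b) //= eqxx mulr1 big1 ?addr0; last first.
  by move=> x /negbTE ->; rewrite mulr0.
rewrite [leRHS]mulrC; apply.
- move=> x y xy; case: eqP => [yb|_]; last by case: eqP.
  suff -> : x = b by rewrite eqxx.
  apply/ffunP => v; apply/eqP; rewrite eq_le ffunE bot_min andbT.
  by have := xy v; rewrite yb ffunE.
- by move=> x v _; have [->|//] := eqVneq x b; rewrite ffunE eqxx.
Qed.

End Coupons.

(** By reversibility the right-hand side is the [pi]-mean of [f x * f y], with [f w] the density of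
    the law at time [t] from [w]. For [p, q >= 0], [p q >= p + q - 1 - |p - 1| - |q - 1|]
    pointwise. *)
Lemma tv_norm_sep t x y :
  1 - 2 * tv_norm (glauber_iter pi t x) pi - 2 * tv_norm (glauber_iter pi t y) pi
    <= glauber_iter pi (t + t) x y / pi y.
Proof.
rewrite glauber_iterD mulr_suml /tv_norm !mulrA !divff // !mul1r.
pose f w z := glauber_iter pi t w z / pi z.
have E w : \sum_z `|glauber_iter pi t w z - pi z| = \sum_z pi z * `|f w z - 1|.
  apply: eq_bigr => z _; rewrite -[X in X * _]gtr0_norm // -normrM /f.
  by congr `|_|; field; rewrite gt_eqF.
have -> : \sum_z glauber_iter pi t x z * glauber_iter pi t z y / pi y =
    \sum_z pi z * (f x z * f y z).
  apply: eq_bigr => z _; have := glauber_iter_sym t z y => yz.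
  have -> : glauber_iter pi t z y = pi y * glauber_iter pi t y z / pi z.
    by rewrite -yz mulrAC divff ?mul1r // gt_eqF.
  by rewrite /f; field; rewrite !gt_eqF.
have mass w : \sum_z pi z * f w z = 1.
  rewrite -(sum_glauber_iter t w); apply: eq_bigr => z _.
  by rewrite /f mulrCA divff ?mulr1 // gt_eqF.
apply: (@le_trans _ _ (\sum_z pi z * (f x z + f y z - 1 - `|f x z - 1| - `|f y z - 1|))).
  rewrite le_eqVlt; apply/orP; left; apply/eqP; rewrite !E -{1}(mass x).
  have -> : \sum_z pi z * f x z = \sum_z pi z * f x z + \sum_z pi z * f y z - \sum_z pi z.
    by rewrite mass pi_sum1 mass; ring.
  by rewrite -big_split -!sumrB; apply: eq_bigr => z _ /=; ring.
apply: ler_sum => z _; rewrite ler_pM2l //.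
have f0 w : 0 <= f w z by rewrite divr_ge0 ?glauber_iter_ge0 // ltW.
move: (f x z) (f y z) (f0 x) (f0 y) => p q p0 q0.
by case: (ger0P (p - 1)) => ?; case: (ger0P (q - 1)) => ?; nra.
Qed.

End Glauber.

Lemma ler_sum_norm (R : realType) (T : finType) (f : T -> R) (x : T) :
  `|f x| <= \sum_y `|f y|.
Proof. by rewrite (bigD1 x) //= lerDl sumr_ge0. Qed.

(** A real [sup] is an upper bound only for bounded sets; on a finite type the sum of the absolute
    values is a bound. *)
Lemma le_sup_range (R : realType) (T : finType) (f : T -> R) (x : T) :
  f x <= sup (range f).
Proof.
apply: ub_le_sup; last by exists x.
exists (\sum_y `|f y|) => _ [y _ <-].
exact: le_trans (ler_norm _) (ler_sum_norm f y).
Qed.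

Lemma ge_inf_range (R : realType) (T : finType) (f : T -> R) (x : T) :
  inf (range f) <= f x.
Proof.
apply: ge_inf; last by exists x.
exists (- \sum_y `|f y|) => _ [y _ <-].
by rewrite lerNl (le_trans (ler_norm _)) // normrN; apply: ler_sum_norm.
Qed.

Lemma finOrder_bot_top (d : Order.disp_t) (S : finOrderType d) : (2 <= #|S|)%N ->
  exists bot top : S, [/\ forall s, (bot <= s)%O, forall s, (s <= top)%O & bot != top].
Proof.
case/card_gt1P => a [b [_ _ ab]].
case: (@arg_minP _ _ _ a predT (fun s : S => s) isT) => bot _ bot_min.
case: (@arg_maxP _ _ _ a predT (fun s : S => s) isT) => top _ top_max.
exists bot, top; split=> [s|s|]; [exact: bot_min|exact: top_max|].
apply: contra_neq ab => bt; have eq_bot s : s = bot.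
  by apply/le_anti/andP; split; [rewrite bt; apply: top_max|apply: bot_min].
by rewrite (eq_bot a) (eq_bot b).
Qed.

(** An inequality on [k] is assumed because the integer part of the time may lie strictly below
    it. *)
Lemma coupon_time_exponent (R : realType) (n k : nat) (c : R) :
  (0 < n)%N -> k%:R <= n%:R * ln n%:R - c * n%:R ->
  expR c <= n%:R * expR (- (k%:R / n%:R)).
Proof.
move=> n0 kn; have N0 : 0 < n%:R :> R by rewrite ltr0n.
rewrite mulrC -ler_pdivrMr // -[n%:R in leLHS]lnK ?posrE // -expRN -expRD ler_expR.
by rewrite lerNr ler_pdivrMr //; lra.
Qed.

(** * Lower bounds on separation and total variation *)

Unset Implicit Arguments.

Theorem theorem5 (R : realType) (d : Order.disp_t) (S : finOrderType d)
    (V : finType) (n : nat) (pi : config S V -> R) (c : R)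
    (hV : #|V| = n) (hn : (0 < n)%N) (hS : (2 <= #|S|)%N)
    (hpi : positive_distribution pi) (hmon : monotone_system pi)
    (hc : 0 < c) :
  (forall t : R, t = n%:R * ln n%:R - c * n%:R -> 0 <= t ->
     1 - expR (- expR c) <= sep_dist_at pi t) /\
  (forall t : R, t = 2^-1 * (n%:R * ln n%:R) - c * n%:R -> 0 <= t ->
     4^-1 - 4^-1 * expR (- expR c) <= tv_dist_at pi t).
Proof.
case: hpi => pi_gt0 pi_sum1.
have V_gt0 : (0 < #|V|)%N by rewrite hV.
have [bot [top [bot_min top_max bot_top]]] := finOrder_bot_top hS.
pose b : config S V := [ffun=> bot]; pose x0 : config S V := [ffun=> top].
have N0 : 0 < n%:R :> R by rewrite ltr0n.
have key (k : nat) (c' : R) : 0 < c' -> k%:R <= n%:R * ln n%:R - c' * n%:R ->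
    glauber_iter pi k x0 b / pi b <= expR (- expR c').
  move=> c'0 kn.
  (* For [n = 1] the logarithm is 0 and the time would be at most [- c'], which is negative. *)
  have n2 : (2 <= n)%N.
    rewrite ltn_neqAle hn andbT; apply/eqP => n1; move: kn.
    rewrite -n1 ln1 !mulr1 mul1r sub0r => kc.
    by have := le_trans (ler0n R k) kc; lra.
  have expc := coupon_time_exponent hn kn.
  have := glauber_iter_top_bot_le pi_gt0 V_gt0 pi_sum1 hmon top_max bot_top.
  move=> /(_ k bot_min) top_bot_le; apply: le_trans top_bot_le _.
  rewrite hV; apply: (@le_trans _ _ (expR (- (n%:R * expR (- (k%:R / n%:R)))))).
    (* The side condition [n exp (- k / n) >= 1] follows from [exp c' >= 1]. *)
    apply: coupon_prob_le => //; rewrite -[leLHS]mul1r ler_pdivrMr // mulrC.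
    by apply: le_trans expc; rewrite -expR0 ler_expR ltW.
  by rewrite ler_expR lerN2.
split=> t tE t0.
- have kt : (Num.truncn t)%:R <= n%:R * ln n%:R - c * n%:R by rewrite -tE truncn_le.
  apply: le_trans (le_sup_range _ x0); rewrite lerD2l lerN2.
  by apply: le_trans (ge_inf_range _ b) _; apply: key.
set k := Num.truncn t.
(* Doubling the time doubles [c]; the resulting bound [exp (- exp (2 c))] is then weakened to
   [exp (- exp c)]. *)
have kt : (k + k)%:R <= n%:R * ln n%:R - (2 * c) * n%:R.
  have : k%:R <= t by rewrite truncn_le.
  by rewrite natrD; lra.
have sep : glauber_iter pi (k + k) x0 b / pi b <= expR (- expR c).
  apply: le_trans (key _ _ _ kt) _; first lra.
  by rewrite ler_expR lerN2 ler_expR; lra.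
have tv x : tv_norm (glauber_iter pi k x) pi <= tv_dist_at pi t.
  exact: (le_sup_range (fun x => tv_norm (glauber_iter pi k x) pi)).
have := tv_norm_sep pi_gt0 V_gt0 pi_sum1 k x0 b.
by have := tv x0; have := tv b; lra.
Qed.
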